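(* Let $(e_n)$ be a basis of a Banach space $X$. Then the following assertions are equivalent: (a) $(e_n)$ is quasi-greedy and reverse conservative. (b) $(e_n)$ satisfies property $( ** )$: there exists a constant $C$ such that for all $x\in X$ and $m\in\mathbb{N}$, $$\|x-G_m(x)\|\le C\,\sigma_m^R(x),\qquad\text{where }\sigma_m^R(x)=\inf\Big\{\Big\|x-\sum_{i\in A}a_ie_i\Big\| : |A|\le m,\ A>\beta_m(x),\ a_i\in\mathbb{R}\ (i\in A)\Big\}.$$
   Context: Standing setting: $X$ is a real Banach space, possibly finite-dimensional, and $(e_n)$ is a seminormalized Schauder basis of $X$ (i.e. $0<\inf_n\|e_n\|\le\sup_n\|e_n\|<\infty$), with biorthogonal functionals $(e_n^* )$. If $\dim X=N<\infty$, $(e_n)_{n=1}^N$ is an algebraic basis, all indices and index sets lie in $\{1,\dots,N\}$ instead of $\mathbb{N}$, and $m\le N$. $\mathrm{supp}(x)=\{n: e_n^*(x)\ne0\}$; for an index set $A$, $1_A=\sum_{i\in A}e_i$ and $|A|$ is its cardinality; $A<B$ means $\max A<\min B$, and for an integer $b$, $A>b$ means every element of $A$ is $>b$ (vacuous if $A=\emptyset$). Greedy approximation: a greedy ordering for $x\in X$ is an injective map $\rho$ from the index set into itself with $\mathrm{supp}(x)$ contained in the range of $\rho$ and $|e_{\rho(j)}^*(x)|\ge|e_{\rho(k)}^*(x)|$ whenever $j<k$. Put $\Lambda_m(x)=\{\rho(1),\dots,\rho(m)\}$, $G_m(x)=\sum_{n\in\Lambda_m(x)}e_n^*(x)e_n$,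 $\beta_m(x)=\max\Lambda_m(x)$. Statements involving $G_m(x)$, $\Lambda_m(x)$, $\beta_m(x)$ are meant for any greedy ordering of $x$ (the same ordering throughout the statement). Definitions: $(e_n)$ is quasi-greedy if there is $C$ with $\|G_m(x)\|\le C\|x\|$ for all $x\in X$, $m\in\mathbb{N}$. It is reverse conservative if there is $\Gamma_r$ with $\|1_A\|\le\Gamma_r\|1_B\|$ for all finite index sets $A,B$ with $B<A$ and $|A|\le|B|$. *)

(* Defs.v *)
From HB Require Import structures.
From mathcomp Require Import all_boot all_order all_algebra.
From mathcomp Require Import finmap.
From mathcomp Require Import all_classical all_reals.
From mathcomp Require Import topology normedtype sequences.
Set Implicit Arguments.
Unset Strict Implicit.
Unset Printing Implicit Defensive.

Import Order.TTheory GRing.Theory Num.Theory.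
Import numFieldNormedType.Exports.
Local Open Scope classical_set_scope.
Local Open Scope ring_scope.

(* Bases of a real Banach space X are indexed from 1, by {1, 2, ...} when
   N = None and by {1, ..., d} when N = Some d. They are given by functions on
   nat; every definition below ignores the values outside the index set. *)
Definition index_range (N : option nat) : set nat :=
  [set n | (0 < n)%N /\ (if N is Some d then (n <= d)%N else true)].

Definition in_range (N : option nat) (A : {fset nat}) : Prop :=
  forall i, i \in A -> index_range N i.

Definition fset_lt (A B : {fset nat}) : Prop :=
  forall i j, i \in A -> j \in B -> (i < j)%N.

Definition indic_sum (R : realType) (X : completeNormedModType R)
    (e : nat -> X) (A : {fset nat}) : X :=
  \sum_(i <- A) e i.

Definition expansion (R : realType) (X : completeNormedModType R)
    (N : option nat) (e : nat -> X) (x : X) (a : nat -> R) : Prop :=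
  if N is Some d then \sum_(1 <= k < d.+1) a k *: e k = x
  else (fun n => \sum_(1 <= k < n.+1) a k *: e k) @ \oo --> x.

(* A Schauder basis if N = None, an algebraic basis if N = Some d. *)
Definition is_basis (R : realType) (X : completeNormedModType R)
    (N : option nat) (e : nat -> X) : Prop :=
  forall x, exists2 a, expansion N e x a &
    forall b, expansion N e x b -> forall n, index_range N n -> b n = a n.

Definition seminormalized (R : realType) (X : completeNormedModType R)
    (N : option nat) (e : nat -> X) : Prop :=
  exists c C : R, 0 < c /\ forall n, index_range N n -> c <= `|e n| <= C.

(* Continuity matters: for an infinite Schauder basis, biorthogonality alone
   does not determine linear functionals. *)
Definition biorthogonal (R : realType) (X : completeNormedModType R)
    (N : option nat) (e : nat -> X) (es : nat -> {linear X -> R^o}) : Prop :=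
  forall n, index_range N n ->
    continuous (es n) /\ forall k, index_range N k -> es n (e k) = (n == k)%:R.

Definition supp (R : realType) (X : completeNormedModType R)
    (N : option nat) (es : nat -> {linear X -> R^o}) (x : X) : set nat :=
  [set n | index_range N n /\ es n x != 0].

Definition greedy_ordering (R : realType) (X : completeNormedModType R)
    (N : option nat) (es : nat -> {linear X -> R^o}) (x : X)
    (rho : nat -> nat) : Prop :=
  [/\ set_fun (index_range N) (index_range N) rho,
      set_inj (index_range N) rho,
      supp N es x `<=` rho @` index_range N &
      forall j k, index_range N j -> index_range N k -> (j < k)%N ->
        `|es (rho k) x| <= `|es (rho j) x| ].

Definition Lambda (rho : nat -> nat) (m : nat) : {fset nat} :=
  [fset rho j | j in iota 1 m]%fset.

Definition greedy_sum (R : realType) (X : completeNormedModType R)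
    (e : nat -> X) (es : nat -> {linear X -> R^o})
    (rho : nat -> nat) (m : nat) (x : X) : X :=
  \sum_(n <- Lambda rho m) es n x *: e n.

Definition beta (rho : nat -> nat) (m : nat) : nat :=
  (\max_(n <- Lambda rho m) n)%N.

Definition quasi_greedy (R : realType) (X : completeNormedModType R)
    (N : option nat) (e : nat -> X) (es : nat -> {linear X -> R^o}) : Prop :=
  exists C : R, forall x rho m,
    greedy_ordering N es x rho -> index_range N m ->
    `|greedy_sum e es rho m x| <= C * `|x|.

Definition reverse_conservative (R : realType) (X : completeNormedModType R)
    (N : option nat) (e : nat -> X) : Prop :=
  exists Gamma : R, forall A B : {fset nat},
    in_range N A -> in_range N B -> fset_lt B A -> (#|` A| <= #|` B|)%N ->
    `|indic_sum e A| <= Gamma * `|indic_sum e B|.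

Definition sigmaR (R : realType) (X : completeNormedModType R)
    (N : option nat) (e : nat -> X) (rho : nat -> nat) (m : nat) (x : X) : R :=
  inf [set r | exists (A : {fset nat}) (a : nat -> R),
    [/\ in_range N A, (#|` A| <= m)%N,
        (forall i, i \in A -> (beta rho m < i)%N) &
        r = `|x - \sum_(i <- A) a i *: e i| ]].

Definition property_starstar (R : realType) (X : completeNormedModType R)
    (N : option nat) (e : nat -> X) (es : nat -> {linear X -> R^o}) : Prop :=
  exists C : R, forall x rho m,
    greedy_ordering N es x rho -> index_range N m ->
    `|x - greedy_sum e es rho m x| <= C * sigmaR N e rho m x.

(* Main.v *)
(* Assume (a), write L = Lambda_m(x), let A > L with |A| <= m, let
   y = x - sum_(i in A) a_i e_i, and let alpha be the least |e_i^*(x)|, i in L.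
   Then F = L u {i in A : |e_i^*(y)| >= alpha} is a greedy set of y, and
   x - G_m(x) = (y - P_F y) + sum_(i in A) c_i e_i with |c_i| <= 2 alpha. The
   first term is controlled by quasi-greediness and the second one by
   alpha |1_A| <= alpha Gamma |1_L| <= alpha Gamma C |1_F|, where
   alpha |1_F| is at most a multiple of |y|. Conversely, A = {} gives
   quasi-greediness, and x = 1_A + 1_B with B as greedy set gives reverse
   conservativeness. *)
Require Import Defs.
From mathcomp Require Import all_boot all_order all_algebra.
From mathcomp Require Import finmap lra.
From mathcomp Require Import all_classical all_reals.
From mathcomp Require Import topology normedtype sequences.

Set Implicit Arguments.
Unset Strict Implicit.
Unset Printing Implicit Defensive.

Import Order.TTheory GRing.Theory Num.Theory.
Import numFieldNormedType.Exports.
Local Open Scope classical_set_scope.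
Local Open Scope ring_scope.

(** * Norms of sums with scalar multipliers in an arbitrary normed space *)

Section SumNorms.
Variables (R : realType) (V : normedModType R) (I : eqType).
Implicit Types (s : seq I) (v : I -> V).

(* A nonnegative monotone multiplier is a positive combination of the
   indicators of suffixes. *)
Lemma norm_sum_monotone_multiplier s v (b : I -> R) (B c : R) :
  pairwise (fun i j => b i <= b j) s ->
  0 <= c -> (forall i, i \in s -> 0 <= b i <= c) ->
  (forall k, `|\sum_(i <- drop k s) v i| <= B) ->
  `|\sum_(i <- s) b i *: v i| <= c * B.
Proof.
elim: s b c => [|i s IHs] b c /=.
  move=> _ c_ge0 _ /(_ 0%N); rewrite !big_nil normr0 => B_ge0.
  exact: mulr_ge0.
move=> /andP[/allP bi_min b_mono] c_ge0 b_bound suffix_bound.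
have /andP[bi_ge0 bi_le] : 0 <= b i <= c by apply: b_bound; rewrite mem_head.
(* Splitting off the smallest value [b i] on the whole list leaves on the tail the multiplier
   [b j - b i], which is again nonnegative and monotone, now with bound [c - b i]. *)
have -> : \sum_(j <- i :: s) b j *: v j =
    b i *: (\sum_(j <- i :: s) v j) + \sum_(j <- s) (b j - b i) *: v j.
  rewrite !big_cons scalerDr -addrA scaler_sumr -big_split /=; congr (_ + _).
  by apply: eq_bigr => j _; rewrite -scalerDl addrC subrK.
apply: le_trans (ler_normD _ _) _.
rewrite normrZ (ger0_norm bi_ge0).
have -> : c * B = b i * B + (c - b i) * B by rewrite -mulrDl addrC subrK.
apply: lerD; first exact: ler_wpM2l (suffix_bound 0%N).
apply: IHs => [||j js|k]; rewrite ?subr_ge0 //.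
- by apply: sub_pairwise b_mono => j k; rewrite lerD2r.
- by rewrite bi_min //= lerD2r; have /andP[] := b_bound j (@mem_behead _ (i :: s) _ js).
- exact: (suffix_bound k.+1).
Qed.

(* The cube is the convex hull of its vertices. *)
Lemma norm_sum_le_signs s v (a : I -> R) (w : V) (B : R) :
  uniq s -> (forall i, i \in s -> `|a i| <= 1) ->
  (forall f : I -> bool, `|w + \sum_(i <- s) (-1) ^+ f i *: v i| <= B) ->
  `|w + \sum_(i <- s) a i *: v i| <= B.
Proof.
elim: s w => [|i s IHs] w /=.
  by move=> _ _ /(_ xpred0); rewrite !big_nil.
move=> /andP[is' us] a_bound sign_bound.
have : `|a i| <= 1 by apply: a_bound; rewrite mem_head.
rewrite ler_norml => /andP[ai_ge ai_le].
(* The sign at [i] is absorbed into [w], which is why the induction keeps [w] general. Redefining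
   [f] at [i] does not disturb the tail, because [i] does not occur in [s]. *)
have vertex (c : bool) : `|w + (-1) ^+ c *: v i + \sum_(j <- s) a j *: v j| <= B.
  apply: IHs => // [j js|f]; first by apply: a_bound; rewrite inE js orbT.
  have := sign_bound (fun j => if j == i then c else f j).
  rewrite big_cons eqxx addrA.
  congr (`|_ + _| <= _); rewrite !big_seq; apply: eq_bigr => j js.
  by case: eqP js is' => // -> ->.
have p0 : 0 <= (1 + a i) / 2 by lra.
have q0 : 0 <= (1 - a i) / 2 by lra.
set S := \sum_(j <- s) a j *: v j in vertex *.
have -> : w + \sum_(j <- i :: s) a j *: v j =
    ((1 + a i) / 2) *: (w + v i + S) + ((1 - a i) / 2) *: (w - v i + S).
  rewrite big_cons -/S [w + v i + S]addrAC [w - v i + S]addrAC.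
  rewrite (scalerDr _ (w + S) (v i)) (scalerDr _ (w + S) (- v i)) scalerN.
  rewrite addrACA -scalerDl -scalerBl.
  have -> : (1 + a i) / 2 + (1 - a i) / 2 = 1 by lra.
  have -> : (1 + a i) / 2 - (1 - a i) / 2 = a i by lra.
  by rewrite scale1r addrCA addrC.
apply: le_trans (ler_normD _ _) _; rewrite normrZ (ger0_norm p0) normrZ (ger0_norm q0).
have -> : B = (1 + a i) / 2 * B + (1 - a i) / 2 * B by lra.
have := vertex false; have := vertex true; rewrite expr0 expr1 scaleN1r scale1r.
by move=> h1 h2; apply: lerD; apply: ler_wpM2l.
Qed.

End SumNorms.

(** * Coefficients, greedy sets and their greedy orderings *)

Section Basis.
Variables (R : realType) (X : completeNormedModType R) (N : option nat).
Variables (e : nat -> X) (es : nat -> {linear X -> R^o}).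
Hypothesis es_biorthogonal : biorthogonal N e es.

Lemma coef_sum (s : seq nat) (a : nat -> R) k :
  uniq s -> (forall i, i \in s -> index_range N i) -> index_range N k ->
  es k (\sum_(i <- s) a i *: e i) = if k \in s then a k else 0.
Proof.
move=> us sN kN; have [_ esE] := es_biorthogonal kN.
rewrite linear_sum /=.
under eq_big_seq => i /sN iN do rewrite linearZ /= esE //.
case: ifPn => ks.
  rewrite (bigD1_seq k) //= eqxx big1 ?addr0 => [|i].
    by rewrite [_ *: _]mulr1.
  by rewrite eq_sym => /negPf->; rewrite scaler0.
rewrite big_seq big1 // => i is'; case: eqP is' ks => [<- ->//|_ _ _].
by rewrite scaler0.
Qed.

(** An order-free description of the possible sets of leading indices of [x]. The inequality is not
    strict, so ties may be broken either way, and the empty list is allowed. *)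
Definition greedy_set (x : X) (s : seq nat) : Prop :=
  [/\ uniq s, (forall i, i \in s -> index_range N i) &
      forall i j, i \in s -> index_range N j -> j \notin s ->
        `|es j x| <= `|es i x| ].

(** List [s] first, then the remaining indices up to a bound [K], each block sorted by nonincreasing
    modulus of the coefficients, and fix all later indices. Greediness of [s] makes the
    concatenation nonincreasing, and the coefficients beyond [K] vanish. *)
Lemma greedy_ordering_of_greedy_set x s M :
  (forall i, index_range N i -> es i x != 0 -> (i <= M)%N) ->
  greedy_set x s ->
  exists2 rho, greedy_ordering N es x rho & Lambda rho (size s) =i s.
Proof.
move=> suppM [us sN sgreedy].
(* In dimension [d] the ordering has to permute all of 1, ..., d. In the infinite case [K] only has
   to dominate [s] and the support of [x]. *)
pose K := if N is Some d then d else maxn M (\max_(i <- s) i).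
have K_range i : index_range N i -> ~~ (i <= K)%N -> N = None.
  by rewrite /K; case: N => // d [_ ->].
have range_K i : (0 < i <= K)%N -> index_range N i.
  by rewrite /K /index_range /=; case: N => [d|] /andP[].
have suppK i : index_range N i -> ~~ (i <= K)%N -> es i x = 0.
  move=> iN iK; have N0 := K_range _ iN iK.
  apply/eqP; apply: contraNT iK => /(suppM _ iN).
  by rewrite /K N0 leq_max => ->.
have sK i : i \in s -> (0 < i <= K)%N.
  move=> is'; have [-> h] := sN _ is'; rewrite /K; case: N h => // _.
  by rewrite leq_max (@leq_bigmax_seq _ s xpredT id i) ?orbT.
pose r i j := `|es j x| <= `|es i x|.
have r_total : total r by move=> i j; exact: le_total.
have r_trans : transitive r by move=> j i k ji kj; exact: le_trans kj ji.
pose t := [seq i <- iota 1 K | i \notin s].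
pose L := sort r s ++ sort r t.
have uL : uniq L.
  rewrite cat_uniq !sort_uniq us filter_uniq ?iota_uniq // andbT /=.
  apply/hasPn => i; rewrite !mem_sort mem_filter => /andP[].
  by [].
have memL i : (i \in L) = (0 < i <= K)%N.
  rewrite mem_cat !mem_sort mem_filter mem_iota add1n ltnS.
  by case: (boolP (i \in s)) => // /sK.
have sizeL : size L = K.
  rewrite -(size_iota 1 K); apply/perm_size/uniq_perm; rewrite ?iota_uniq //.
  by move=> i; rewrite memL mem_iota add1n ltnS.
have L_r : pairwise r L.
  rewrite pairwise_cat -!(sorted_pairwise r_trans) !sort_sorted // !andbT.
  apply/allrelP => i j; rewrite !mem_sort mem_filter mem_iota => is'.
  move=> /andP[js jK]; apply: sgreedy => //.
  by apply: range_K; rewrite add1n ltnS in jK.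
(* Positions are counted from 1 and list entries from 0, hence [j.-1]. Since [L] enumerates exactly
   1, ..., K, the identity elsewhere preserves injectivity. *)
pose rho j := if (0 < j <= K)%N then nth 0%N L j.-1 else j.
have rhoP j : (0 < j <= K)%N -> rho j \in L.
  by move=> jK; rewrite /rho jK mem_nth // sizeL; case: j jK.
have rho_out j : ~~ (0 < j <= K)%N -> rho j = j by rewrite /rho => /negPf->.
have outK j : index_range N j -> ~~ (0 < j <= K)%N -> ~~ (j <= K)%N.
  by move=> [-> _].
exists rho.
  split.
  - move=> j jN; case: (boolP (0 < j <= K)%N) => jK; last by rewrite rho_out.
    by apply: range_K; rewrite -memL rhoP.
  - move=> j k /set_mem jN /set_mem kN.
    case: (boolP (0 < j <= K)%N) => jK; case: (boolP (0 < k <= K)%N) => kK.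
    + rewrite /rho jK kK => /eqP; rewrite nth_uniq ?sizeL //.
      * by case: j k jK kK {jN kN} => [|j] [|k] //= _ _ /eqP->.
      * by case: j jK {jN}.
      * by case: k kK {kN}.
    + by rewrite (rho_out k) // => jk; move: (rhoP _ jK); rewrite memL jk (negPf kK).
    + by rewrite (rho_out j) // => jk; move: (rhoP _ kK); rewrite memL -jk (negPf jK).
    + by rewrite !rho_out.
  - move=> n [nN nx].
    have nL : n \in L.
      rewrite memL; have [n0 _] := nN; rewrite n0 /=.
      by apply: contraNT nx => /(suppK _ nN) ->.
    have iK : (0 < (index n L).+1 <= K)%N by rewrite -sizeL index_mem.
    exists (index n L).+1; first exact: range_K.
    by rewrite /rho iK nth_index.
  - move=> j k jN kN jk.
    case: (boolP (0 < k <= K)%N) => kK; last first.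
      by rewrite rho_out // suppK ?normr0 ?outK.
    have jK : (0 < j <= K)%N.
      by have [-> _] := jN; case/andP: kK => _; apply/leq_trans/ltnW.
    rewrite /rho jK kK; apply: (pairwiseP 0%N L_r); rewrite ?inE ?sizeL.
    + by case: j jK {jN jk}.
    + by case: k kK {kN jk}.
    + by case: j k jK kK jk {jN kN} => [|j] [|k].
have sizes : (size s <= K)%N.
  by rewrite -sizeL size_cat size_sort leq_addr.
have rho_s j : (0 < j <= size s)%N -> rho j = nth 0%N (sort r s) j.-1.
  move=> /andP[j0 js]; rewrite /rho j0 (leq_trans js) //= nth_cat size_sort.
  by rewrite prednK // js.
move=> i; rewrite -(mem_sort r s); apply/imfsetP/idP => /=.
  move=> [j]; rewrite mem_iota add1n ltnS => js ->.
  rewrite rho_s // mem_nth // size_sort; by case: j js.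
move=> is'.
have js : (0 < (index i (sort r s)).+1 <= size s)%N.
  by rewrite -(size_sort r) index_mem.
exists (index i (sort r s)).+1; first by rewrite mem_iota add1n ltnS.
by rewrite rho_s // nth_index.
Qed.

(** * Basis expansions and the threshold of a greedy ordering *)

Hypothesis e_basis : is_basis N e.

Lemma index_iota_range_None n k :
  N = None -> k \in index_iota 1 n -> index_range N k.
Proof. by rewrite mem_index_iota /index_range => -> /andP[]. Qed.

(** In the infinite case, continuity carries [es k] through the limit of the partial sums, on which
    its value is constantly [a k] as soon as the sum reaches index [k]. *)
Lemma expansion_coefs x : expansion N e x (fun k => es k x).
Proof.
have [a xa _] := e_basis x.
suff esa k : index_range N k -> es k x = a k.
  move: esa xa; rewrite /expansion /index_range; case: N => [d|] esa.
    move=> xa; rewrite -[RHS]xa; apply: eq_big_nat => k /andP[k0 kd].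
    by rewrite -esa //; split.
  rewrite (_ : (fun n => \sum_(1 <= k < n.+1) es k x *: e k) =
    (fun n => \sum_(1 <= k < n.+1) a k *: e k)) //; apply/funext => n.
  by apply: eq_big_nat => k /andP[k0 _]; rewrite -esa //; split.
move=> kN; have [es_cont _] := es_biorthogonal kN.
move: xa; rewrite /expansion; case EN: N => [d|] xa.
  rewrite -xa coef_sum ?iota_uniq // => [|i]; last first.
    by rewrite mem_index_iota EN => /andP[].
  by move: kN; rewrite EN mem_index_iota ltnS => -[-> ->].
have sum_cvg := continuous_cvg (eventually_filter) (es_cont x) xa.
apply: (cvg_unique (@norm_hausdorff _ R^o) sum_cvg).
apply: cvg_near_cst; near=> n.
rewrite /= coef_sum ?iota_uniq // => [|i]; last exact: index_iota_range_None.
rewrite mem_index_iota; have [-> _] := kN.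
have -> // : (k < n.+1)%N.
by near: n; exact: nbhs_infty_ge.
Unshelve. all: by end_near. Qed.

(** The last selected coefficient is the threshold alpha of the main estimate. Monotonicity of [rho]
    compares it with every other position, and an index that [rho] misses has coefficient zero. *)
Lemma Lambda_greedy x rho m :
  greedy_ordering N es x rho -> index_range N m ->
  [/\ in_range N (Lambda rho m), #|` Lambda rho m| = m,
      forall i, i \in Lambda rho m -> `|es (rho m) x| <= `|es i x| &
      forall j, index_range N j -> j \notin Lambda rho m ->
        `|es j x| <= `|es (rho m) x| ].
Proof.
move=> [rhoN rho_inj rho_supp rho_mono] mN; have [m_gt0 m_le] := mN.
have iotaN i : (0 < i <= m)%N -> index_range N i.
  move=> /andP[i0 im]; split=> //; move: m_le.
  by case: N => // d; exact: leq_trans.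
split=> [_ /imfsetP[i /= im ->]||_ /imfsetP[i /= im ->]|j jN jL].
- by apply: rhoN; apply: iotaN; rewrite mem_iota add1n ltnS in im.
- rewrite card_in_imfset /= ?undup_id ?iota_uniq ?size_iota // => i j /=.
  rewrite !mem_iota !add1n !ltnS => im jm.
  by apply: rho_inj; apply/mem_set; exact: iotaN.
- rewrite mem_iota add1n ltnS in im; have iN := iotaN _ im.
  case: (ltngtP i m) => [lt_im|gt_im|->//]; first exact: rho_mono.
  by case/andP: im => _; rewrite leqNgt gt_im.
- have [->|jx] := eqVneq (es j x) 0; first by rewrite normr0.
  have [k kN rhok] : (rho @` index_range N) j by apply: rho_supp; split.
  rewrite -rhok; case: (leqP k m) => [km|]; last exact: rho_mono.
  case/negP: jL; apply/imfsetP; exists k => //=.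
  by rewrite mem_iota add1n ltnS km; have [-> _] := kN.
Qed.

(** * Consequences of quasi-greediness for signed and unsigned sums of basis vectors *)

Section QuasiGreedy.
Variable C : R.
Hypothesis C_ge0 : 0 <= C.
Hypothesis greedy_sum_le : forall x rho m,
  greedy_ordering N es x rho -> index_range N m ->
  `|greedy_sum e es rho m x| <= C * `|x|.

Lemma norm_greedy_set_finite_supp x s M :
  (forall i, index_range N i -> es i x != 0 -> (i <= M)%N) ->
  greedy_set x s -> `|\sum_(i <- s) es i x *: e i| <= C * `|x|.
Proof.
move=> suppM xs; have [us sN _] := xs.
(* The hypothesis concerns only m at least 1, so the empty set is treated apart. *)
case: (posnP (size s)) => [/size0nil->|s_gt0].
  by rewrite big_nil normr0 mulr_ge0.
have [rho rho_greedy rho_s] := greedy_ordering_of_greedy_set suppM xs.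
have sizeN : index_range N (size s).
  split=> //; case EN: N => [d|] //.
  rewrite -(size_iota 1 d); apply: uniq_leq_size => // i /sN.
  by rewrite EN mem_iota add1n ltnS => -[-> ->].
have := greedy_sum_le rho_greedy sizeN.
by rewrite /greedy_sum (perm_big s) //; apply: uniq_perm => //; exact: fset_uniq.
Qed.

(* Passing to partial sums reduces to finitely supported vectors, so no
   ordering of an infinite support has to be constructed. *)
Lemma norm_greedy_set x s :
  greedy_set x s -> `|\sum_(i <- s) es i x *: e i| <= C * `|x|.
Proof.
move=> xs; have [us sN s_greedy] := xs.
case EN: N => [d|].
  apply: (@norm_greedy_set_finite_supp _ _ d) => // i.
  by rewrite EN => -[].
have := expansion_coefs x; rewrite /expansion EN.
set S := fun n => \sum_(1 <= k < n.+1) es k x *: e k.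
move=> Sx; have CSx : C * `|S n| @[n --> \oo] --> C * `|x|.
  by apply: cvgM; [exact: cvg_cst|exact: cvg_norm].
(* Once [n] exceeds all of [s], truncation keeps the coefficients on [s] and can only annihilate
   others, so [s] remains a greedy set of [S n]. *)
apply: (ler_cvg_to (cvg_cst _) CSx); near=> n.
have Sn i : index_range N i ->
    es i (S n) = if i \in index_iota 1 n.+1 then es i x else 0.
  by apply: coef_sum => [|j]; [exact: iota_uniq|exact: index_iota_range_None].
have s_n i : i \in s -> i \in index_iota 1 n.+1.
  move=> is'; rewrite mem_index_iota; have [-> _] := sN _ is'.
  rewrite /= ltnS (leq_trans (@leq_bigmax_seq _ s xpredT id i _ _)) //.
  by near: n; exact: nbhs_infty_ge.
have -> : \sum_(i <- s) es i x *: e i = \sum_(i <- s) es i (S n) *: e i.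
  by apply: eq_big_seq => i is'; rewrite (Sn _ (sN _ is')) s_n.
apply: (@norm_greedy_set_finite_supp _ _ n).
  move=> i iN; rewrite Sn // mem_index_iota ltnS.
  by case: (i <= n)%N; rewrite ?andbF ?eqxx.
split=> // i j is' jN js; rewrite (Sn _ jN) (Sn _ (sN _ is')) (s_n _ is').
by case: ifP => _; [exact: s_greedy|rewrite normr0].
Unshelve. all: by end_near. Qed.

(** All nonzero coefficients of the full signed sum have modulus 1, so every part of [s] is a greedy
    set of it. *)
Lemma norm_subset_signs s (p : pred nat) (f : nat -> bool) :
  uniq s -> (forall i, i \in s -> index_range N i) ->
  `|\sum_(i <- s | p i) (-1) ^+ f i *: e i| <=
    C * `|\sum_(i <- s) (-1) ^+ f i *: e i|.
Proof.
move=> us sN; set y := \sum_(i <- s) _.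
have y_coef i : index_range N i -> es i y = if i \in s then (-1) ^+ f i else 0.
  exact: coef_sum.
have -> : \sum_(i <- s | p i) (-1) ^+ f i *: e i =
    \sum_(i <- [seq i <- s | p i]) es i y *: e i.
  rewrite big_filter big_seq_cond [RHS]big_seq_cond.
  by apply: eq_bigr => i /andP[is' _]; rewrite (y_coef _ (sN _ is')) is'.
apply: norm_greedy_set; split=> [|i|i j]; first exact: filter_uniq.
  by rewrite mem_filter => /andP[_ /sN].
rewrite mem_filter => /andP[_ is'] jN _.
rewrite (y_coef _ jN) (y_coef _ (sN _ is')) is' normr_sign.
by case: ifP; rewrite ?normr_sign ?normr0.
Qed.

(** Split [s] according to whether the two signs agree. Up to a global sign, each half is a partial
    sum of the [f]-signed sum and costs one factor [C]. *)
Lemma norm_change_signs s (f g : nat -> bool) :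
  uniq s -> (forall i, i \in s -> index_range N i) ->
  `|\sum_(i <- s) (-1) ^+ g i *: e i| <=
    2 * C * `|\sum_(i <- s) (-1) ^+ f i *: e i|.
Proof.
move=> us sN; rewrite (bigID (fun i => f i == g i)) /=.
rewrite (eq_bigr (fun i => (-1) ^+ f i *: e i)) => [|i /eqP-> //].
rewrite [X in _ + X](eq_bigr (fun i => - ((-1) ^+ f i *: e i))); last first.
  by move=> i; case: (f i) (g i) => -[]; rewrite // ?expr0 ?expr1 -scaleNr ?opprK.
rewrite sumrN; apply: le_trans (ler_normB _ _) _.
have -> (u : R) : 2 * C * u = C * u + C * u by lra.
by apply: lerD; exact: norm_subset_signs.
Qed.

(** After division by [alpha], convexity reduces the coefficients to signs, and replacing these by
    +1 costs the factor [2 * C]. The division is why [alpha = 0] is separate. *)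
Lemma norm_sum_le_indicator s (a : nat -> R) (alpha : R) :
  uniq s -> (forall i, i \in s -> index_range N i) ->
  0 <= alpha -> (forall i, i \in s -> `|a i| <= alpha) ->
  `|\sum_(i <- s) a i *: e i| <= 2 * C * (alpha * `|\sum_(i <- s) e i|).
Proof.
move=> us sN; rewrite le_eqVlt => /orP[/eqP<- a0|alpha_gt0 a_le].
  rewrite mul0r mulr0 big_seq big1 ?normr0 // => i /a0.
  by rewrite normr_le0 => /eqP->; rewrite scale0r.
have -> : \sum_(i <- s) a i *: e i =
    alpha *: (0 + \sum_(i <- s) (alpha^-1 * a i) *: e i).
  rewrite add0r scaler_sumr; apply: eq_bigr => i _.
  by rewrite scalerA mulrA mulfV ?mul1r // gt_eqF.
rewrite normrZ gtr0_norm // mulrCA ler_pM2l //.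
apply: norm_sum_le_signs => // [i /a_le ai|f].
  by rewrite normrM gtr0_norm ?invr_gt0 // mulrC ler_pdivrMr // mul1r.
rewrite add0r; apply: le_trans (norm_change_signs (fun=> false) f us sN) _.
rewrite (eq_bigr e) // => i _; exact: scale1r.
Qed.

(** The sum is first estimated with the signs of the coefficients of [x]. One factor [2 * C] comes
    from differences of greedy sums, the other from removing the signs. *)
Lemma norm_indicator_greedy_set x s (alpha : R) :
  greedy_set x s -> 0 <= alpha -> (forall i, i \in s -> alpha <= `|es i x|) ->
  alpha * `|\sum_(i <- s) e i| <= 2 * C * (2 * C * `|x|).
Proof.
move=> [us sN s_greedy]; rewrite le_eqVlt => /orP[/eqP<- _|alpha_gt0 le_x].
  by rewrite mul0r !mulr_ge0.
pose f i := es i x < 0.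
have sign_le : alpha * `|\sum_(i <- s) (-1) ^+ f i *: e i| <= 2 * C * `|x|.
  pose r i j := `|es j x| <= `|es i x|.
  have r_trans : transitive r by move=> j i k ji kj; exact: le_trans kj ji.
  have r_total : total r by move=> i j; exact: le_total.
  (* Along [t] the moduli are nonincreasing, so each prefix is a greedy set of [x] and [b] is
     nondecreasing with values in [0, 1]. *)
  pose t := sort r s; pose b i := alpha / `|es i x|.
  have t_r : pairwise r t by rewrite -sorted_pairwise // sort_sorted.
  have memt i : (i \in t) = (i \in s) by rewrite mem_sort.
  have tN i : i \in t -> index_range N i by rewrite memt => /sN.
  have t_gt0 i : i \in t -> 0 < `|es i x|.
    by rewrite memt => /le_x; exact: lt_le_trans.
  have take_greedy k : greedy_set x (take k t).
    split=> [|i|i j ik jN jk]; first by rewrite take_uniq ?sort_uniq.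
      by move=> /mem_take /tN.
    case: (boolP (j \in s)) => [js|]; last first.
      by apply: s_greedy => //; rewrite -memt (mem_take ik).
    move: t_r; rewrite -{1}(cat_take_drop k t) pairwise_cat => /andP[tt _].
    apply: (allrelP tt) => //.
    by move: js; rewrite -memt -{1}(cat_take_drop k t) mem_cat (negPf jk).
  (* Up to signs, alpha 1_s is the monotone multiplier alpha / |e_i^*(x)|
     applied to the greedy sum, whose suffixes are differences of greedy sums. *)
  have -> : alpha * `|\sum_(i <- s) (-1) ^+ f i *: e i| =
      `|\sum_(i <- t) b i *: (es i x *: e i)|.
    rewrite -{1}(gtr0_norm alpha_gt0) -normrZ scaler_sumr.
    rewrite (perm_big t) /=; last by rewrite perm_sym perm_sort.
    congr (`|_|); apply: eq_big_seq => i it; rewrite !scalerA; congr (_ *: _).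
    rewrite /b [X in _ = _ * X]realEsign ?num_real // mulrACA.
    by rewrite mulVf ?mulr1 // gt_eqF ?t_gt0.
  rewrite -[leRHS]mul1r; apply: norm_sum_monotone_multiplier => // [|i it|k].
  - apply: (@sub_in_pairwise _ (mem t) r _ _ t _ t_r); last exact/allP.
    move=> i j it jt ij; rewrite ler_pM2l // lef_pV2 ?posrE ?t_gt0 //.
  - rewrite divr_ge0 ?(ltW alpha_gt0) //= ler_pdivrMr ?mul1r ?t_gt0 //.
    by rewrite le_x // -memt.
  - have -> : \sum_(i <- drop k t) es i x *: e i =
        \sum_(i <- t) es i x *: e i - \sum_(i <- take k t) es i x *: e i.
      by rewrite -{2}(cat_take_drop k t) big_cat addrC addKr.
    apply: le_trans (ler_normB _ _) _.
    have -> : 2 * C * `|x| = C * `|x| + C * `|x| by lra.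
    apply: lerD; apply: norm_greedy_set => //.
    by have := take_greedy (size t); rewrite take_size.
have := norm_change_signs f (fun=> false) us sN.
rewrite (eq_bigr e) => [e_le|i _]; last exact: scale1r.
apply: le_trans (ler_wpM2l (ltW alpha_gt0) e_le) _.
by rewrite mulrCA ler_wpM2l // mulr_ge0.
Qed.

(** * Quasi-greediness and reverse conservativeness imply [property_starstar] *)

Lemma norm_sub_greedy_sum (Gamma : R) x rho m (A : {fset nat}) (a : nat -> R) :
  0 <= Gamma ->
  (forall A B : {fset nat}, in_range N A -> in_range N B -> fset_lt B A ->
    (#|` A| <= #|` B|)%N ->
    `|indic_sum e A| <= Gamma * `|indic_sum e B|) ->
  greedy_ordering N es x rho -> index_range N m ->
  in_range N A -> (#|` A| <= m)%N ->
  (forall i, i \in A -> (beta rho m < i)%N) ->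
  `|x - greedy_sum e es rho m x| <=
    (1 + C + 2 * C * (2 * (Gamma * (C * (2 * C * (2 * C)))))) *
      `|x - \sum_(i <- A) a i *: e i|.
Proof.
move=> Gamma_ge0 rc rhox mN AN Am A_beta.
have [LN cardL L_ge L_le] := Lambda_greedy rhox mN.
set L := Lambda rho m in LN cardL L_ge L_le *.
set alpha := `|es (rho m) x| in L_ge L_le.
have alpha_ge0 : 0 <= alpha by exact: normr_ge0.
have LA : fset_lt L A.
  move=> i j iL /A_beta; apply: leq_ltn_trans.
  exact: (@leq_bigmax_seq _ _ xpredT id i).
have LnA i : i \in L -> i \notin A.
  by move=> iL; apply/negP => /(LA _ _ iL); rewrite ltnn.
set y := x - \sum_(i <- A) a i *: e i.
have y_coef i : index_range N i -> es i y = es i x - (if i \in A then a i else 0).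
  by move=> iN; rewrite linearB /= coef_sum ?fset_uniq.
have yE i : index_range N i -> i \notin A -> es i y = es i x.
  by move=> iN /negPf iA; rewrite y_coef // iA subr0.
pose big i := alpha <= `|es i y|.
pose F : seq nat := L ++ [seq i <- A | big i].
have F_greedy : greedy_set y F.
  split=> [|i|i j].
  - rewrite cat_uniq fset_uniq filter_uniq ?fset_uniq // andbT /=.
    apply/hasPn => i; rewrite mem_filter => /andP[_ iA].
    by apply: contraL iA; exact: LnA.
  - by rewrite mem_cat mem_filter => /orP[/LN|/andP[_ /AN]].
  - move=> iF jN; rewrite mem_cat mem_filter negb_or negb_and => /andP[jL jA].
    have le_alpha : `|es j y| <= alpha.
      case: (boolP (j \in A)) jA => [_|jA _]; last by rewrite yE // L_le.
      by rewrite orbF -ltNge => /ltW.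
    apply: le_trans le_alpha _.
    move: iF; rewrite mem_cat mem_filter => /orP[iL|/andP[]//].
    by rewrite (yE _ (LN _ iL) (LnA _ iL)) L_ge.
have [uF FN _] := F_greedy.
have F_ge i : i \in F -> alpha <= `|es i y|.
  rewrite mem_cat mem_filter => /orP[iL|/andP[]//].
  by rewrite (yE _ (LN _ iL) (LnA _ iL)) L_ge.
(* For [i] in [A], if [big i] holds then [c i] is the coefficient of [x], at most [alpha] in modulus
   because [i] is outside [L]. Otherwise [c i = a i] is the difference of the coefficients of [x]
   and [y], both bounded by [alpha]. *)
pose c i := a i + (if big i then es i y else 0).
have c_le i : i \in A -> `|c i| <= 2 * alpha.
  move=> iA; have iN := AN _ iA.
  have x_le : `|es i x| <= alpha.
    by apply: L_le => //; apply: contraL iA; exact: LnA.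
  rewrite /c; case: ifP => [_|/negbT].
    rewrite y_coef // iA addrC subrK; apply: le_trans x_le _; lra.
  rewrite -ltNge addr0 => y_lt.
  have -> : a i = es i x - es i y by rewrite y_coef // iA opprB addrC subrK.
  apply: le_trans (ler_normB _ _) _; lra.
have -> : x - greedy_sum e es rho m x =
    (y - \sum_(i <- F) es i y *: e i) + \sum_(i <- A) c i *: e i.
  have -> : greedy_sum e es rho m x = \sum_(i <- L) es i y *: e i.
    by apply: eq_big_seq => i iL; rewrite yE ?LnA //; exact: LN.
  have -> : \sum_(i <- A) c i *: e i =
      \sum_(i <- A) a i *: e i + \sum_(i <- A | big i) es i y *: e i.
    rewrite [X in _ = _ + X]big_mkcond -big_split; apply: eq_bigr => i _ /=.
    by rewrite scalerDl; case: ifP; rewrite ?scale0r.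
  rewrite big_cat big_filter /= opprD !addrA.
  by rewrite addrAC subrK addrAC subrK.
have F_bound : alpha * `|\sum_(i <- F) e i| <= 2 * C * (2 * C * `|y|).
  exact: norm_indicator_greedy_set.
have LF : `|\sum_(i <- L) e i| <= C * `|\sum_(i <- F) e i|.
  (* With all signs +1, the indices of [F] lying in [L] are exactly those of [L], since the rest of
     [F] lies in [A]. *)
  have := norm_subset_signs (mem L) (fun=> false) uF FN.
  rewrite (eq_bigr e) => [|i _]; last exact: scale1r.
  rewrite [in leRHS](eq_bigr e) => [|i _]; last exact: scale1r.
  rewrite {1}/F big_cat /= [X in _ + X]big1_seq ?addr0 => [|i]; last first.
    by rewrite mem_filter => /and3P[/LnA/negPf-> _].
  by rewrite -big_filter (_ : [seq i <- L | _] = L) //; apply/all_filterP/allP.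
have A_bound : alpha * `|\sum_(i <- A) e i| <=
    Gamma * (C * (2 * C * (2 * C * `|y|))).
  have := rc _ _ AN LN LA; rewrite cardL => /(_ Am) AL.
  have := le_trans AL (ler_wpM2l Gamma_ge0 LF).
  move=> /(ler_wpM2l alpha_ge0) h; apply: le_trans h _.
  by rewrite mulrCA ler_wpM2l // mulrCA ler_wpM2l.
apply: le_trans (ler_normD _ _) _.
rewrite mulrDl mulrDl mul1r; apply: lerD.
  by apply: le_trans (ler_normB _ _) _; rewrite lerD2l; exact: norm_greedy_set.
have c_bound : `|\sum_(i <- A) c i *: e i| <=
    2 * C * (2 * alpha * `|\sum_(i <- A) e i|).
  by apply: norm_sum_le_indicator => //; rewrite ?fset_uniq ?mulr_ge0.
apply: le_trans c_bound _.
have -> : 2 * C * (2 * (Gamma * (C * (2 * C * (2 * C))))) * `|y| =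
    2 * C * (2 * (Gamma * (C * (2 * C * (2 * C * `|y|))))) by rewrite !mulrA.
rewrite -(mulrA 2 alpha); apply: ler_wpM2l; first by rewrite mulr_ge0.
exact: ler_wpM2l A_bound.
Qed.

End QuasiGreedy.

Lemma quasi_greedy_reverse_conservative_starstar :
  quasi_greedy N e es -> reverse_conservative N e -> property_starstar N e es.
Proof.
move=> [C qg] [Gamma rc].
have greedy_sum_le x rho m : greedy_ordering N es x rho -> index_range N m ->
    `|greedy_sum e es rho m x| <= `|C| * `|x|.
  move=> rhox mN; apply: le_trans (qg _ _ _ rhox mN) _.
  by rewrite ler_wpM2r // ler_norm.
have rc' (A B : {fset nat}) : in_range N A -> in_range N B -> fset_lt B A ->
    (#|` A| <= #|` B|)%N -> `|indic_sum e A| <= `|Gamma| * `|indic_sum e B|.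
  move=> AN BN BA AB; apply: le_trans (rc _ _ AN BN BA AB) _.
  by rewrite ler_wpM2r // ler_norm.
set c := `|C| in greedy_sum_le; set g := `|Gamma| in rc'.
have c_ge0 : 0 <= c by exact: normr_ge0.
have g_ge0 : 0 <= g by exact: normr_ge0.
pose K := 1 + c + 2 * c * (2 * (g * (c * (2 * c * (2 * c))))).
have K_gt0 : 0 < K by rewrite ltr_wpDr ?ltr_wpDr // !mulr_ge0.
exists K => x rho m rhox mN.
(* Division by [K], positive thanks to its summand 1, turns the claim into a lower bound for the set
   defining [sigmaR]; the empty set of indices shows that this set is nonempty. *)
rewrite mulrC -ler_pdivrMr //; apply: lb_le_inf.
  by exists `|x - \sum_(i <- fset0) 0 *: e i|, fset0, (fun=> 0).
move=> _ [A [a [AN Am A_beta ->]]]; rewrite ler_pdivrMr // mulrC.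
exact: norm_sub_greedy_sum.
Qed.

(** * Property [property_starstar] implies quasi-greediness and reverse conservativeness *)

Lemma sigmaR_le x rho m (A : {fset nat}) (a : nat -> R) :
  in_range N A -> (#|` A| <= m)%N ->
  (forall i, i \in A -> (beta rho m < i)%N) ->
  sigmaR N e rho m x <= `|x - \sum_(i <- A) a i *: e i|.
Proof.
move=> AN Am A_beta; apply: ge_inf; last by exists A, a.
by exists 0 => _ [B [b [_ _ _ ->]]].
Qed.

Lemma sigmaR_ge0 x rho m : 0 <= sigmaR N e rho m x.
Proof.
apply: lb_le_inf; last by move=> _ [B [b [_ _ _ ->]]].
by exists `|x - \sum_(i <- fset0) 0 *: e i|, fset0, (fun=> 0).
Qed.

Lemma starstar_quasi_greedy :
  property_starstar N e es -> quasi_greedy N e es.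
Proof.
move=> [C ss]; exists (1 + `|C|) => x rho m rhox mN.
have sub_le : `|x - greedy_sum e es rho m x| <= `|C| * `|x|.
  apply: le_trans (ss _ _ _ rhox mN) _.
  (* The constant [C] is not assumed nonnegative, so it is replaced by its absolute value before
     [sigmaR] is enlarged. *)
  apply: (@le_trans _ _ (`|C| * sigmaR N e rho m x)).
    by apply: ler_wpM2r; [exact: sigmaR_ge0|exact: ler_norm].
  apply: ler_wpM2l => //.
  have := @sigmaR_le x rho m fset0 (fun=> 0).
  rewrite big_nil subr0; by apply.
rewrite mulrDl mul1r.
rewrite -[greedy_sum _ _ _ _ _](subKr x).
by apply: le_trans (ler_normB _ _) _; rewrite lerD2l.
Qed.

Lemma starstar_reverse_conservative :
  property_starstar N e es -> reverse_conservative N e.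
Proof.
move=> [C ss]; exists `|C| => A B AN BN BA AB.
(* The number of greedy terms will be the size of [B], which must be at least 1; an empty [B] forces
   [A] to be empty. *)
case: (fset_0Vmem B) => [B0|[b0 b0B]].
  move: AB; rewrite B0 cardfs0 leqn0 cardfs_eq0 => /eqP->.
  by rewrite /indic_sum !big_nil normr0 mulr0.
have BnA i : i \in B -> i \notin A.
  by move=> iB; apply/negP => /(BA _ _ iB); rewrite ltnn.
pose s : seq nat := B ++ A.
have us : uniq s.
  rewrite cat_uniq !fset_uniq andbT; apply/hasPn => i iA.
  by apply: contraL iA; exact: BnA.
have sN i : i \in s -> index_range N i.
  by rewrite mem_cat => /orP[/BN|/AN].
pose x := \sum_(i <- s) 1 *: e i.
have x_coef i : index_range N i -> es i x = if i \in s then 1 else 0.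
  exact: coef_sum.
have Bs i : i \in B -> i \in s by rewrite mem_cat => ->.
have x_supp i : index_range N i -> es i x != 0 -> (i <= \max_(j <- s) j)%N.
  move=> iN; rewrite x_coef //; case: ifP => [is' _|]; last by rewrite eqxx.
  exact: (@leq_bigmax_seq _ s xpredT id i).
(* The coefficients of [x] are 0 or 1, so the ties between [A] and [B] may be broken in favour of
   [B]. *)
have B_greedy : greedy_set x B.
  split=> // [|i j iB jN _]; first exact: fset_uniq.
  rewrite (x_coef _ jN) (x_coef _ (BN _ iB)) (Bs _ iB).
  by case: ifP; rewrite ?normr0 ?normr1.
have [rho rhox LB] := greedy_ordering_of_greedy_set x_supp B_greedy.
have mN : index_range N (size B).
  split; first by rewrite -has_predT; apply/hasP; exists b0.
  case EN: N => [d|] //; rewrite -(size_iota 1 d).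
  apply: uniq_leq_size => [|i /BN]; first exact: fset_uniq.
  by rewrite EN mem_iota add1n ltnS => -[-> ->].
have LE : Lambda rho (size B) = B by apply/fsetP.
have xE : x = indic_sum e B + indic_sum e A.
  by rewrite /x big_cat; congr (_ + _); apply: eq_bigr => i _; rewrite scale1r.
have GE : greedy_sum e es rho (size B) x = indic_sum e B.
  rewrite /greedy_sum LE; apply: eq_big_seq => i iB.
  by rewrite (x_coef _ (BN _ iB)) (Bs _ iB) scale1r.
have xB : x - indic_sum e B = indic_sum e A by rewrite xE addrAC subrr add0r.
have := ss _ _ _ rhox mN; rewrite GE xB => A_le.
apply: le_trans A_le _.
apply: (@le_trans _ _ (`|C| * sigmaR N e rho (size B) x)).
  by apply: ler_wpM2r; [exact: sigmaR_ge0|exact: ler_norm].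
apply: ler_wpM2l => //.
(* Subtracting [A] with coefficients 1 is an admissible competitor in [sigmaR], since [A] lies
   beyond [B] and has at most as many elements. *)
have -> : indic_sum e B = x - \sum_(i <- A) 1 *: e i.
  rewrite xE (eq_bigr e) => [|i _]; last exact: scale1r.
  by rewrite addrK.
apply: sigmaR_le => // i iA.
(* The default value of the maximum is 0, which lies below [i] because indices start at 1. *)
rewrite /beta LE big_seq; apply: (big_ind (fun n => (n < i)%N)).
- by have [] := AN _ iA.
- by move=> j k ji ki; rewrite gtn_max ji ki.
- by move=> j jB; exact: BA.
Qed.

End Basis.

Theorem theorem2p11 (R : realType) (X : completeNormedModType R)
    (N : option nat) (e : nat -> X) (es : nat -> {linear X -> R^o})
    (e_basis : is_basis N e) (e_seminormalized : seminormalized N e)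
    (es_biorthogonal : biorthogonal N e es) :
  (quasi_greedy N e es /\ reverse_conservative N e) <->
  property_starstar N e es.
Proof.
split=> [[qg rc]|ss]; first exact: quasi_greedy_reverse_conservative_starstar.
split; first exact: starstar_quasi_greedy.
exact: starstar_reverse_conservative ss.
Qed.
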